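(* There exists a function $f:\mathbb{N}\to\mathbb{N}$ such that for every integer $k\geq 0$, every positive integer $m$ and every finite group $G$ in which the set of $\delta_k^*$-commutators has size $m$, one has $|\delta_k^*(G)|\leq f(m)$. (That is, $|\delta_k^*(G)|$ is $m$-bounded, with a bound depending only on $m$ and not on $k$ or $G$.)
   Context: Let $G$ be a finite group; $|a|$ denotes the order of the element $a$ and $[a,b]$ is the commutator $a^{-1}b^{-1}ab$. The $\delta_k^*$-commutators of $G$ are defined recursively. Every element of $G$ is a $\delta_0^*$-commutator. For $k\geq 1$, let $Y$ be the set of all elements of $G$ that are powers of $\delta_{k-1}^*$-commutators; an element $g\in G$ is a $\delta_k^*$-commutator if there exist $a,b\in Y$ such that $g=[a,b]$ and $(|a|,|b|)=1$. The subgroup of $G$ generated by all $\delta_k^*$-commutators is denoted by $\delta_k^*(G)$. The term ''$m$-bounded'' means bounded by a function of $m$ only. *)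

(* Defs.v *)
From mathcomp Require Import all_boot all_fingroup.

Set Implicit Arguments.
Unset Strict Implicit.
Unset Printing Implicit Defensive.

Local Open Scope group_scope.

Section DeltaStar.

Variable gT : finGroupType.
Implicit Types (A G : {set gT}) (k : nat).

(* In a finite group every element of the cyclic group <[x]> is a power
   x ^+ i, so this is the set of all powers of elements of A. *)
Definition powers_of A : {set gT} := \bigcup_(x in A) <[x]>.

Fixpoint delta_star_commutators k G : {set gT} :=
  if k is k'.+1 then
    let Y := powers_of (delta_star_commutators k' G) in
    [set [~ a, b] | a in Y, b in Y & coprime #[a] #[b]]
  else G.

Definition delta_star k G : {set gT} := <<delta_star_commutators k G>>.

End DeltaStar.

(* Main.v *)
(** Let X be the set of delta_k^*-commutators of G, m = #|X| and D = <<X>>.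
    Since X is normal in G, each of its elements has at most m conjugates in D, so
    #|D : 'Z(D)| <= m ^ m and, by Schur's theorem, D' has m-bounded order.

    Working modulo D', let g = [a, b] in X, with a and b coprime powers of
    delta_(k-1)^*-commutators and b a pi-element, and let A be the pi'-part of the
    abelian group D / D'.  The set R = {[x, b] | x in A} is a subgroup with
    R = {[c, b] | c in R}, so its elements are images of delta_j^*-commutators for
    all j <= k, by induction on j; hence #|R| <= m.  The norm of g under b is
    [a, b ^ #[b]] = 1, and this forces the pi'-part of g to have exponent #|R|.
    Exchanging a and b deals with the pi-part, so g ^ m! lies in D'.

    Both D' and D / D' are thus generated by small normal sets whose elements
    satisfy a short power relation, which bounds their orders by Dietzmann's
    argument. *)
Require Import Defs.
From mathcomp Require Import all_boot all_fingroup all_solvable.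

Set Implicit Arguments.
Unset Strict Implicit.
Unset Printing Implicit Defensive.

Local Open Scope group_scope.

(** * Dietzmann's argument for normal generating sets, and Schur's theorem *)

Section NormalGeneratingSets.

Variable gT : finGroupType.
Implicit Types (X : {set gT}) (D : {group gT}).

Lemma mem_expgsP X n x :
  x \in X ^+ n -> exists s, [/\ size s = n, all [in X] s & x = \prod_(y <- s) y].
Proof.
elim: n x => [|n IHn] x; first by rewrite expg0 => /set1P->; exists nil; rewrite big_nil.
rewrite expgS => /mulsgP[y z Xy /IHn[s [sz_s Xs ->]] ->].
by exists (y :: s); rewrite /= sz_s big_cons; split=> //; apply/andP.
Qed.

Lemma prod_mem_expgs X s : all [in X] s -> \prod_(y <- s) y \in X ^+ size s.
Proof.
elim: s => [|y s IHs] /=; first by rewrite big_nil expg0 set11.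
by case/andP=> Xy Xs; rewrite big_cons expgS mem_mulg ?IHs.
Qed.

Lemma expg_mem_expgs X n x : x \in X -> x ^+ n \in X ^+ n.
Proof. by move=> Xx; elim: n => [|n IHn]; rewrite ?set11 // !expgS mem_mulg. Qed.

Lemma card_mulg_leq (A B : {set gT}) : #|A * B| <= #|A| * #|B|.
Proof. by rewrite -cardsX [A * B]curry_imset2X leq_imset_card. Qed.

Lemma card_expgs_leq X n : #|X ^+ n| <= (#|X| ^ n)%N.
Proof.
elim: n => [|n IHn]; first by rewrite expg0 cards1.
by rewrite expgS expnS (leq_trans (card_mulg_leq _ _)) // leq_mul2l IHn orbT.
Qed.

(** By [y * x ^+ j = x ^+ j * y ^ (x ^+ j)], copies of [x] move to the front past any factor, which
    is replaced by a conjugate and so stays in [X]. *)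
Lemma prod_collect X x j s :
    x \in X -> X \subset 'N(X) -> all [in X] s -> j <= count_mem x s ->
  exists2 z, z \in X ^+ (size s - j) & \prod_(y <- s) y = x ^+ j * z.
Proof.
move=> Xx nXX; elim: s j => [|y s IHs] [|j] //.
- by move=> _ _; exists 1; rewrite ?big_nil ?mulg1 ?set11.
- move=> Xs _; exists (\prod_(i <- y :: s) i); last by rewrite mul1g.
  exact: prod_mem_expgs.
move=> /= /andP[Xy Xs]; rewrite big_cons subSS; have [->|_] := eqVneq y x.
  by rewrite add1n ltnS => /(IHs _ Xs)[z Xz ->]; exists z; rewrite // expgS mulgA.
rewrite add0n => le_js; have [z Xz ->] := IHs _ Xs le_js.
exists (y ^ (x ^+ j.+1) * z); last first.
  by rewrite mulgA (conjgC y) -mulgA.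
have ->: (size s - j = (size s - j.+1).+1)%N.
  by rewrite subnSK // (leq_trans le_js) // count_size.
by rewrite [X ^+ _]expgS mem_mulg // memJ_norm // groupX // (subsetP nXX).
Qed.

Lemma size_sum_count X (s : seq gT) :
  all [in X] s -> size s = \sum_(x in X) count_mem x s.
Proof.
elim: s => [|y s IHs] /=; first by rewrite big1.
case/andP=> Xy Xs; rewrite big_split -IHs //= (bigD1 y) //= eqxx big1 // => x.
by rewrite eq_sym => /andP[_ /negbTE->].
Qed.

(* Pigeonhole: in a product of more than [r * #|X|] factors some [x] occurs
   [r.+1] times; conjugation gathers these occurrences in front, where
   [x ^+ r.+1] can be rewritten with [r] factors. *)
Lemma card_gen_normal_leq X r :
    1 \in X -> X \subset 'N(X) -> {in X, forall x, x ^+ r.+1 \in X ^+ r} ->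
  #|<<X>>| <= (#|X| ^ (r * #|X|))%N.
Proof.
move=> X1 nXX Xr; set N := (r * #|X|)%N.
have X_gt0: 0 < #|X| by apply/card_gt0P; exists 1.
have shrink: X ^+ N.+1 \subset X ^+ N.
  apply/subsetP=> u /mem_expgsP[s [sz_s Xs ->]].
  have [x Xx ltrx]: exists2 x, x \in X & r < count_mem x s.
    apply/exists_inP; apply: contraLR (ltnSn N); rewrite -leqNgt => /exists_inPn small.
    rewrite -sz_s (size_sum_count Xs) /N mulnC -sum_nat_const leq_sum // => x Xx.
    by rewrite leqNgt small.
  have [z Xz ->] := prod_collect Xx nXX Xs ltrx.
  rewrite -[N](subnKC (leq_pmulr r X_gt0)) expgnDr mem_mulg ?Xr //.
  by rewrite sz_s subSS in Xz.
(* Since [1 \in X], [<<X>>] is a power of [X], and by [shrink] every power lies in [X ^+ N]. *)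
apply: leq_trans (card_expgs_leq X N); apply/subset_leq_card.
have [n ->] := gen_expgs X; rewrite (setUidPr _) ?sub1set //.
elim: n => [|n IHn]; first by rewrite sub1set -(expg1n _ N) expg_mem_expgs.
by rewrite (subset_trans _ shrink) // !expgS mulgS.
Qed.

(** The centralizer of the set is an intersection of point centralizers, whose indices are class
    sizes; the index of an intersection is at most the product. *)
Lemma index_cent_set_leq D m (s : seq gT) :
    {in s, forall x, #|x ^: D| <= m} -> #|D : 'C([set x in s])| <= (m ^ size s)%N.
Proof.
elim: s => [|x s IHs] classm /=.
  rewrite (eqP (_ : #|_ : _| == 1%N)) // indexg_eq1.
  by apply/centsP=> y _ z; rewrite inE.
rewrite set_cons centU cent_set1 -indexgI [X in _ :&: X]setIC setIA.
set C := 'C([set y in s]).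
rewrite -(Lagrange_index (subsetIl D C)); last exact: subsetIl.
rewrite expnSr leq_mul //.
  by rewrite indexgI IHs // => y sy; rewrite classm // inE sy orbT.
rewrite index_cent1 (leq_trans _ (classm x _)) ?mem_head //.
by rewrite subset_leq_card // imsetS // subsetIl.
Qed.

(** The value of [card_gen_normal_leq] for [n * n] commutators and [r = n]. *)
Definition schur_bound n := ((n * n) ^ (n * (n * n)))%N.

Lemma leq_schur_bound n1 n2 : n1 <= n2 -> schur_bound n1 <= schur_bound n2.
Proof.
(* At [n1 = 0] the bound is [0 ^ 0 = 1]. *)
case: n1 => [|n1] le12.
  by rewrite /schur_bound mul0n expn0 expn_gt0; case: n2 {le12}.
have n2_gt0 : 0 < n2 by apply: leq_trans le12.
apply: leq_trans (_ : ((n2 * n2) ^ (n1.+1 * (n1.+1 * n1.+1)) <= _)%N).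
  by rewrite leq_exp2r ?muln_gt0 // leq_mul.
by rewrite leq_pexp2l ?muln_gt0 ?n2_gt0 // !leq_mul.
Qed.

(* With [c = [~ x, y]] and [c ^+ n] central,
   [c ^+ n.+1 = c * (c ^ y) ^+ n = [~ x, y ^+ 2] * [~ x ^ y, y] ^+ n.-1]
   is a product of [n] commutators. *)
Lemma card_der1_leq D : #|D^`(1)| <= schur_bound #|D : 'Z(D)|.
Proof.
set n := #|D : 'Z(D)|; set K := commg_set D D.
have n_gt0: 0 < n := indexg_gt0 _ _.
have K1: 1 \in K by apply/imset2P; exists 1 1; rewrite ?group1 // comm1g.
have K_gt0: 0 < #|K| by apply/card_gt0P; exists 1.
have nKD: D \subset 'N(K).
  apply/subsetP=> z Dz; rewrite inE; apply/subsetP.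
  move=> _ /imsetP[_ /imset2P[x y Dx Dy ->] ->].
  by rewrite conjRg; apply: imset2_f; rewrite memJ_norm ?(subsetP (normG D)).
have sKD: K \subset D.
  by apply/subsetP=> _ /imset2P[x y Dx Dy ->]; rewrite groupR.
(* [[~ x, y]] depends only on the cosets of [x] and [y] modulo the centre. *)
have cardK: #|K| <= n * n.
  rewrite -[n]/#|rcosets 'Z(D) D| -cardsX.
  apply: leq_trans (leq_imset_card (fun p => [~ repr p.1, repr p.2]) _).
  apply/subset_leq_card/subsetP=> _ /imset2P[x y Dx Dy ->].
  apply/imsetP; exists ('Z(D) :* x, 'Z(D) :* y).
    by rewrite inE !mem_rcosets !(subsetP (mulG_subr _ _)).
  have cZ g h : g \in 'Z(D) -> h \in D -> [~ g, h] = 1.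
    by case/centerP=> _ cg Dh; apply/eqP/commgP/cg.
  rewrite /=; case: (repr_rcosetP 'Z(D) x) => g Zg; case: (repr_rcosetP 'Z(D) y) => h Zh.
  have [Dg Dh] := (subsetP (center_sub D) _ Zg, subsetP (center_sub D) _ Zh).
  rewrite commMgJ (cZ g) ?groupM // conj1g mul1g -[LHS]invg_comm -[RHS]invg_comm.
  by rewrite commMgJ cZ // conj1g mul1g.
have Kn: {in K, forall c, c ^+ n.+1 \in K ^+ n}.
  move=> _ /imset2P[x y Dx Dy ->]; set c := [~ x, y].
  have Dc : c \in D by rewrite groupR.
  have /centerP[_ /(_ y Dy) cZ]: c ^+ n \in 'Z(D).
    have nZD := normal_norm (center_normal D).
    apply: coset_idr; first by rewrite (subsetP nZD) ?groupX.
    rewrite morphX ?(subsetP nZD) // /n -card_quotient //.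
    by rewrite expg_cardG // mem_quotient.
  have cJ: (c ^+ n) ^ y = c ^+ n by apply/conjg_fixP/commgP.
  have ->: c ^+ n.+1 = [~ x, y ^+ 2] * [~ x ^ y, y] ^+ n.-1.
    rewrite expgS -cJ conjXg.
    rewrite expgS expg1 commgMJ -/c -[RHS]mulgA; congr (c * _).
    have <-: c ^ y = [~ x ^ y, y] by rewrite conjRg [y ^ y]mulKg.
    by rewrite -expgS prednK.
  rewrite -[in K ^+ n](prednK n_gt0) [K ^+ _]expgS mem_mulg //; last first.
    apply: expg_mem_expgs; apply: imset2_f => //.
    by rewrite groupJ.
  by apply: imset2_f; rewrite ?groupX.
apply: leq_trans (card_gen_normal_leq K1 (subset_trans sKD nKD) Kn) _.
rewrite /schur_bound (leq_trans (_ : _ <= (n * n) ^ (n * #|K|))%N) //.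
  by rewrite leq_exp2r ?muln_gt0 ?n_gt0.
by rewrite leq_pexp2l ?muln_gt0 ?n_gt0 // leq_mul.
Qed.

End NormalGeneratingSets.

(** * Commutators of an abelian group with a fixed normalizing element *)

Section AbelianCommutators.

Variables (gT : finGroupType) (A : {group gT}) (b : gT).
Hypotheses (cAA : abelian A) (nAb : b \in 'N(A)).

Definition commutators_with := [set [~ a, b] | a in A].

Lemma commg_mem_abelian a : a \in A -> [~ a, b] \in A.
Proof. by move=> Aa; rewrite commgEl groupM ?groupV ?memJ_norm. Qed.

Lemma commMg_abelian x y : x \in A -> y \in A -> [~ x * y, b] = [~ x, b] * [~ y, b].
Proof.
move=> Ax Ay; rewrite commMgJ (conjg_fixP _) //.
by apply/commgP/(centsP cAA); rewrite ?commg_mem_abelian.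
Qed.

Lemma commXg_abelian x i : x \in A -> [~ x ^+ i, b] = [~ x, b] ^+ i.
Proof.
move=> Ax; elim: i => [|i IHi]; first exact: comm1g.
by rewrite !expgS commMg_abelian ?groupX ?IHi.
Qed.

Lemma commutators_with_group_set : group_set commutators_with.
Proof.
apply/group_setP; split=> [|_ _ /imsetP[x Ax ->] /imsetP[y Ay ->]].
  by apply/imsetP; exists 1; rewrite ?comm1g.
by rewrite -commMg_abelian // (imset_f (fun a => [~ a, b])) ?groupM.
Qed.

Canonical commutators_with_group := Group commutators_with_group_set.

Lemma commutators_with_sub : commutators_with \subset A.
Proof. by apply/subsetP=> _ /imsetP[x Ax ->]; apply: commg_mem_abelian. Qed.

(* If [c = [~ a, b]] commutes with [b] then
   [c ^+ #[b] = [~ a, b ^+ #[b]] = 1]; by coprimality [c = 1], so that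
   [c |-> [~ c, b]] is injective on the set of all [[~ a, b]]. *)
Lemma commutators_with_idem :
    coprime #|A| #[b] ->
  [set [~ c, b] | c in commutators_with] = commutators_with.
Proof.
move=> coAb; apply/eqP; rewrite eqEcard; apply/andP; split.
  by rewrite imsetS // commutators_with_sub.
rewrite card_in_imset // => c d Rc Rd eq_cd.
have [Ac Ad] := (subsetP commutators_with_sub _ Rc, subsetP commutators_with_sub _ Rd).
have /imsetP[a Aa def_a]: d * c^-1 \in commutators_with by rewrite groupM ?groupV.
have Ae: d * c^-1 \in A by rewrite groupM ?groupV.
have eb1: [~ d * c^-1, b] = 1.
  apply: (mulIg [~ c, b]); rewrite -commMg_abelian // mulgKV mul1g.
  exact: esym.
have eX1: (d * c^-1) ^+ #[b] = 1.
  rewrite def_a -commgX ?expg_order ?commg1 // -def_a.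
  by apply/commute_sym/commgP; rewrite eb1.
apply/esym/eqP; rewrite eq_mulgV1 -order_eq1 -dvdn1 -(eqnP coAb) dvdn_gcd.
by rewrite order_dvdG // order_dvdn eX1 eqxx.
Qed.

(* The norm [y * y ^ b * ... * y ^ (b ^+ n.-1)]. *)
Definition conj_norm n y := iter n (fun z => y * z ^ b) 1.

Lemma conj_norm_mem n y : y \in A -> conj_norm n y \in A.
Proof. by move=> Ay; elim: n => //= n IHn; rewrite groupM ?memJ_norm. Qed.

(** Telescoping by [[~ a, b ^+ n.+1] = [~ a, b] * [~ a, b ^+ n] ^ b]. *)
Lemma conj_norm_commg n a : conj_norm n [~ a, b] = [~ a, b ^+ n].
Proof.
elim: n => [|n IHn]; first by rewrite commg1.
by rewrite /= IHn -commgMJ -expgSr.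
Qed.

Lemma conj_normX n y j : y \in A -> conj_norm n (y ^+ j) = conj_norm n y ^+ j.
Proof.
move=> Ay; elim: n => [|n IHn]; first by rewrite expg1n.
rewrite /= IHn conjXg [RHS]expgMn //.
by apply: (centsP cAA); rewrite ?memJ_norm ?conj_norm_mem.
Qed.

Lemma conj_norm_fix n y : y ^ b = y -> conj_norm n y = y ^+ n.
Proof. by move=> yb; elim: n => //= n ->; rewrite conjXg yb expgS. Qed.

End AbelianCommutators.

(* [y := [~ a, b].`_pi^'] has trivial norm under [b], and [y ^+ e] commutes
   with [b] when [e] is the order of the group of all [[~ x, b]]; hence
   [y ^+ e] has order dividing both [#[b]] and a [pi^']-number. *)
Lemma commg_constt_exponent (gT : finGroupType) (M : {group gT}) (a b : gT)
    (pi : nat_pred) :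
    abelian M -> b \in 'N(M) -> pi.-elt b -> [~ a, b] \in M ->
  [~ a, b].`_pi^' ^+ #|commutators_with 'O_pi^'(M) b| = 1.
Proof.
move=> cMM nMb pi_b Mg; set g := [~ a, b]; set y := g.`_pi^'.
set A := 'O_pi^'(M)%G.
have sAM : A \subset M := pcore_sub _ _.
have cAA : abelian A := abelianS sAM cMM.
have nAb : b \in 'N(A) by rewrite (subsetP (char_norms (pcore_char _ _))).
(* The norm of [g] is [[~ a, b ^+ #[b]] = 1], and norms respect powers, so [y] is written as a power
   of [g]. *)
have [j def_y]: exists j, y = g ^+ j by apply/cycleP/cycle_constt.
have My : y \in M by rewrite def_y groupX.
have Ay : y \in A.
  rewrite (mem_normal_Hall (nilpotent_pcore_Hall _ (abelian_nil cMM))) ?pcore_normal //.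
  exact: p_elt_constt.
set e := #|_|; set u := y ^+ e.
have Au : u \in A by rewrite groupX.
have ub : u ^ b = u.
  apply/conjg_fixP; rewrite (commXg_abelian cAA nAb) //.
  rewrite -order_dvdn (order_dvdG (G := commutators_with_group cAA nAb)) //.
  by rewrite (imset_f (fun a => [~ a, b])).
have: u ^+ #[b] == 1.
  rewrite -(conj_norm_fix _ ub) (conj_normX cMM nMb) //.
  rewrite def_y (conj_normX cMM nMb) // conj_norm_commg.
  by rewrite expg_order commg1 !expg1n.
rewrite -order_dvdn => u_b; apply/eqP; rewrite -order_eq1 -dvdn1.
have coAb: coprime #|A| #[b].
  by rewrite coprime_sym (pnat_coprime pi_b) //; apply: pcore_pgroup.
by rewrite -(eqnP coAb) dvdn_gcd order_dvdG.
Qed.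

(** * The sets of commutators and their images in quotients *)

Section DeltaStarCommutators.

Variables (gT : finGroupType) (G : {group gT}).
Implicit Types (k : nat) (x y : gT).

Local Notation dcomm k := (delta_star_commutators k G).

Lemma powers_ofP (X : {set gT}) x :
  reflect (exists2 y, y \in X & x \in <[y]>) (x \in powers_of X).
Proof. exact: bigcupP. Qed.

Lemma mem_powers_of (X : {set gT}) x : x \in X -> x \in powers_of X.
Proof. by move=> Xx; apply/powers_ofP; exists x; rewrite ?cycle_id. Qed.

Lemma powers_ofS (X1 X2 : {set gT}) : X1 \subset X2 -> powers_of X1 \subset powers_of X2.
Proof.
move=> sX; apply/subsetP=> x /powers_ofP[y Xy xy].
by apply/powers_ofP; exists y; rewrite ?(subsetP sX).
Qed.

Lemma delta_star_commP k x :
  reflect (exists a b, [/\ a \in powers_of (dcomm k), b \in powers_of (dcomm k),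
                           coprime #[a] #[b] & x = [~ a, b]])
          (x \in dcomm k.+1).
Proof.
apply: (iffP imset2P) => [[a b Ya] | [a [b [Ya Yb co_ab ->]]]].
  by rewrite inE => /andP[Yb co_ab] ->; exists a, b.
by exists a b; rewrite // inE Yb.
Qed.

Lemma delta_star_comm_sub k : dcomm k \subset G.
Proof.
elim: k => [|k /subsetP IHk] //; apply/subsetP=> _ /delta_star_commP[a [b [Ya Yb _ ->]]].
have YG c : c \in powers_of (dcomm k) -> c \in G.
  by case/powers_ofP=> y /IHk Gy; apply: (subsetP _ c); rewrite cycle_subG.
by rewrite groupR ?YG.
Qed.

Lemma powers_of_delta_sub k : powers_of (dcomm k) \subset G.
Proof.
apply/bigcupsP=> x Xx; rewrite cycle_subG; exact: (subsetP (delta_star_comm_sub k)).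
Qed.

Lemma delta_star_comm1 k : 1 \in dcomm k.
Proof.
elim: k => [|k IHk]; first exact: group1.
apply/delta_star_commP; exists 1, 1; rewrite comm1g order1.
by split=> //; apply: mem_powers_of.
Qed.

Lemma delta_star_comm_norm k : G \subset 'N(dcomm k).
Proof.
elim: k => [|k IHk]; first exact: normG.
apply/subsetP=> g Gg; rewrite inE; apply/subsetP.
move=> _ /imsetP[_ /delta_star_commP[a [b [Ya Yb co ->]]] ->].
have YJ c : c \in powers_of (dcomm k) -> c ^ g \in powers_of (dcomm k).
  case/powers_ofP=> y Xy yc; apply/powers_ofP; exists (y ^ g).
    by rewrite memJ_norm ?(subsetP IHk).
  by rewrite cycleJ memJ_conjg.
apply/delta_star_commP; exists (a ^ g), (b ^ g); rewrite conjRg !orderJ.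
by split=> //; apply: YJ.
Qed.

Lemma delta_star_comm_subS k : dcomm k.+1 \subset dcomm k.
Proof.
elim: k => [|k IHk]; first exact: delta_star_comm_sub.
apply/subsetP=> x /delta_star_commP[a [b [Ya Yb co ->]]].
by apply/delta_star_commP; exists a, b; split=> //; apply: (subsetP (powers_ofS IHk)).
Qed.

Lemma delta_star_comm_anti j k : j <= k -> dcomm k \subset dcomm j.
Proof.
move/subnK<-; elim: (k - j) => [|i IHi] //.
exact: subset_trans (delta_star_comm_subS _) IHi.
Qed.

(* Each [[~ a, b]] is again of the form [[~ c, b]] with [c] of this form, so it
   is the image of a delta_j-commutator for all [j <= k.+1] in turn. *)
Lemma commutators_with_delta_star (N : {group gT}) (A : {group coset_of N})
    (pi : nat_pred) k b :
    G \subset 'N(N) -> A \subset G / N -> abelian A -> pi^'.-group A ->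
    b \in powers_of (dcomm k) -> pi.-elt b -> coset N b \in 'N(A) ->
  commutators_with A (coset N b) \subset coset N @: dcomm k.+1.
Proof.
move=> nNG sAG cAA pi'A Yb pi_b nAb; set R := commutators_with _ _.
have nNb : b \in 'N(N) by rewrite (subsetP nNG) ?(subsetP (powers_of_delta_sub k)).
have sRA : R \subset A := commutators_with_sub nAb.
have defR : [set [~ c, coset N b] | c in R] = R.
  apply: commutators_with_idem => //.
  by rewrite coprime_sym (pnat_coprime (morph_p_elt [morphism of coset N] nNb pi_b)).
suffices: forall j, j <= k.+1 -> R \subset coset N @: dcomm j by apply.
elim=> [_ | j IHj lt_jk].
  apply: subset_trans sRA (subset_trans sAG _).
  by rewrite quotientE morphimEsub.
rewrite -defR; apply/subsetP=> _ /imsetP[c Rc ->].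
have /imsetP[x Xx def_c] := subsetP (IHj (ltnW lt_jk)) c Rc.
have nNx : x \in 'N(N) by rewrite (subsetP nNG) ?(subsetP (delta_star_comm_sub j)).
(* The order of [x] need not be coprime to that of [b]; its [pi^']-part is a power of [x] with the
   same image, as [c] is a [pi^']-element. *)
have {def_c} ->: c = coset N x.`_pi^'.
  by rewrite morph_constt //= -def_c constt_p_elt // (mem_p_elt pi'A) ?(subsetP sRA).
have nNy : x.`_pi^' \in 'N(N) by rewrite groupX.
rewrite -morphR //; apply: imset_f; apply/delta_star_commP.
exists x.`_pi^', b; split=> //.
- by apply/powers_ofP; exists x; rewrite ?cycle_constt.
- exact: (subsetP (powers_ofS (delta_star_comm_anti (lt_jk : j <= k))) _ Yb).
- by rewrite coprime_sym (pnat_coprime pi_b) //; apply: p_elt_constt.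
Qed.

(** * Exponents modulo the derived subgroup, and the final bound *)

Lemma delta_star_normal k : delta_star k G <| G.
Proof.
by rewrite /normal gen_subG delta_star_comm_sub norms_gen ?delta_star_comm_norm.
Qed.

Lemma coset_delta_star_comm_exponent k x :
    x \in dcomm k.+1 ->
  coset (delta_star k.+1 G)^`(1) x ^+ (#|dcomm k.+1|)`! = 1.
Proof.
set X := dcomm k.+1; set D := <<X>>%G; set N := D^`(1)%G => Xx.
have nDG : G \subset 'N(D) := normal_norm (delta_star_normal _).
have nNG : G \subset 'N(N) by rewrite (subset_trans nDG) // char_norms ?der_char.
have sXN : X \subset 'N(N) by rewrite (subset_trans (delta_star_comm_sub _)).
have cMM : abelian (D / N) := der_abelian 0 D.
have sMG : D / N \subset G / N by rewrite quotientS ?normal_sub ?delta_star_normal.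
have YG c : c \in powers_of (dcomm k) -> c \in G := subsetP (powers_of_delta_sub k) c.
(* Kept general in [pi]: it is applied to [(a, b)] with the primes of [#[b]], and to [(b, a)] with
   the complementary set. *)
have half a b (pi : nat_pred) : a \in powers_of (dcomm k) -> b \in powers_of (dcomm k) ->
    pi.-elt b -> [~ a, b] \in X -> (coset N [~ a, b]).`_pi^' ^+ (#|X|)`! = 1.
  move=> Ya Yb pi_b Xab.
  have [nNa nNb] : a \in 'N(N) /\ b \in 'N(N) by rewrite !(subsetP nNG) ?YG.
  have nMb : coset N b \in 'N(D / N).
    by rewrite (subsetP (quotient_norms N nDG)) // mem_quotient ?YG.
  have pi_bN : pi.-elt (coset N b) := morph_p_elt [morphism of coset N] nNb pi_b.
  rewrite morphR //=; set A := 'O_pi^'(D / N)%G.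
  have nAb : coset N b \in 'N(A) by rewrite (subsetP (char_norms (pcore_char _ _))).
  have Mab : [~ coset N a, coset N b] \in D / N.
    by rewrite -morphR // mem_quotient ?mem_gen.
  have cAA : abelian A := abelianS (pcore_sub _ _) cMM.
  have sAG : A \subset G / N := subset_trans (pcore_sub _ _) sMG.
  have leRX : #|commutators_with A (coset N b)| <= #|X|.
    apply: leq_trans (leq_imset_card (coset N) X); apply: subset_leq_card.
    exact: (commutators_with_delta_star nNG sAG cAA (pcore_pgroup _ _) Yb pi_b nAb).
  have := commg_constt_exponent cMM nMb pi_bN Mab.
  have R_gt0 : 0 < #|commutators_with A (coset N b)|.
    exact: (cardG_gt0 (commutators_with_group cAA nAb)).
  (* The factorial is a common multiple of all positive integers up to [#|X|]. *)
  have /dvdnP[q ->] : #|commutators_with A (coset N b)| %| (#|X|)`!.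
    by rewrite dvdn_fact // R_gt0.
  by rewrite mulnC expgM => ->; rewrite expg1n.
have /delta_star_commP[a [b [Ya Yb co_ab def_x]]] := Xx.
pose pi : nat_pred := \pi(#[b]).
have pi_b : pi.-elt b by apply: pnat_pi.
have pi'a : pi^'.-elt a by rewrite /p_elt -coprime_pi' // coprime_sym.
have XV : [~ b, a] \in X.
  by apply/delta_star_commP; exists b, a; rewrite coprime_sym.
have Eb : (coset N x).`_pi^' ^+ (#|X|)`! = 1 by rewrite def_x half // -def_x.
have Ea : (coset N x).`_pi ^+ (#|X|)`! = 1.
  have := half b a _ Yb Ya pi'a XV; rewrite consttNK -invg_comm -def_x.
  rewrite morphV /= ?(subsetP sXN) // consttV expgVn => /eqP.
  by rewrite invg_eq1 => /eqP.
rewrite -[coset N x](consttC pi) expgMn ?Ea ?Eb ?mulg1 //.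
by apply: commuteX2 (commute_refl _).
Qed.

(** The two factors bound the derived subgroup and the abelianization, in this order. *)
Lemma card_delta_starS_leq k (m := #|dcomm k.+1|) :
  #|delta_star k.+1 G| <= schur_bound (m ^ m) * m ^ ((m`!).-1 * m).
Proof.
set X := dcomm k.+1 in m *; rewrite -[delta_star _ _]/<<X>>.
set D := <<X>>%G; set N := D^`(1)%G.
have X1 : 1 \in X := delta_star_comm1 _.
have nXG : G \subset 'N(X) := delta_star_comm_norm _.
have sXG : X \subset G := delta_star_comm_sub _.
have sDG : D \subset G by rewrite gen_subG.
have nND : D \subset 'N(N) := der_norm 1 D.
have sXD : X \subset D := subset_gen X.
have sXN : X \subset 'N(N) := subset_trans sXD nND.
rewrite -(Lagrange (der_sub 1 D)) leq_mul //; last first.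
  rewrite -card_quotient // quotient_gen //.
  have XNE : X / N = coset N @: X by rewrite quotientE morphimEsub.
  have m_gt0 : 0 < m by apply/card_gt0P; exists 1.
  have leXN : #|X / N| <= m by rewrite XNE leq_imset_card.
  (* With [r.+1] equal to the factorial of [m], [x ^+ r.+1 = 1] is a product of [r] copies of
     [1]. *)
  apply: leq_trans (card_gen_normal_leq (r := (m`!).-1) _ _ _) _.
  - by rewrite XNE; apply/imsetP; exists 1; rewrite ?morph1.
  - by rewrite quotient_norms // (subset_trans sXG).
  - rewrite XNE => _ /imsetP[x Xx ->]; rewrite prednK ?fact_gt0 //.
    rewrite coset_delta_star_comm_exponent // -(expg1n _ (m`!).-1) expg_mem_expgs //.
    by apply/imsetP; exists 1; rewrite ?morph1.
  apply: (leq_trans (n := (m ^ ((m`!).-1 * #|X / N|))%N)).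
    by case: (_.-1 * _)%N => // i; rewrite leq_exp2r.
  by rewrite leq_pexp2l ?leq_mul.
apply: leq_trans (card_der1_leq D) (leq_schur_bound _).
(* Centralizing [D] amounts to centralizing [X], and the [D]-classes of elements of [X] lie in
   [X]. *)
have ->: #|D : 'Z(D)| = #|D : 'C([set x in enum X])|.
  by rewrite indexgI /= cent_gen set_enum.
rewrite [m]cardE index_cent_set_leq // => x; rewrite mem_enum -cardE => Xx.
apply/subset_leq_card/subsetP=> _ /imsetP[g Dg ->].
by rewrite memJ_norm // (subsetP nXG) // (subsetP sDG).
Qed.

End DeltaStarCommutators.

Theorem theorem1p2 :
  exists f : nat -> nat,
    forall (k m : nat) (gT : finGroupType) (G : {group gT}),
      0 < m ->
      #|delta_star_commutators k G| = m ->
      #|delta_star k G| <= f m.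
Proof.
(* The summand [m] serves [k = 0], where the commutators form [G] itself. *)
exists (fun m => m + schur_bound (m ^ m) * m ^ ((m`!).-1 * m))%N.
move=> [|k] m gT G _ <-; first by rewrite /delta_star genGid leq_addr.
exact: leq_trans (card_delta_starS_leq _ _) (leq_addl _ _).
Qed.
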